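(* For a function $f\colon\mathbb{R}\to\mathbb{R}$ the following are equivalent: (i) $f$ is the pointwise limit of a sequence of Świątkowski functions; (ii) $f\in\mathfrak{S}$, i.e. $f$ has the Baire property and, for every residual set $A\subset\mathbb{R}$ and every $\varepsilon>0$, $f$ satisfies the condition $S(A,\varepsilon)$.
   Context: $\mathrm{C}(f)$ denotes the set of continuity points of $f$. $f$ is a Świątkowski function if for all $a<b$ with $f(a)\ne f(b)$ there is $x\in(a,b)\cap\mathrm{C}(f)$ with $f(x)$ strictly between $f(a)$ and $f(b)$. A function has the Baire property if preimages of open sets have the Baire property; a set is residual if its complement is meager. For $a,b\in\mathbb{R}$, $I(a,b)$ is the open interval with end-points $a,b$. For $A\subset\mathbb{R}$, an interval $J$ and $\varepsilon\ge0$, $f$ satisfies $S(J,A,\varepsilon)$ if for all $a,b\in J$ with $f(a)<f(b)$ there exists $x\in A\cap I(a,b)$ with $f(x)\in(f(a)-\varepsilon,f(b)+\varepsilon)$. $f$ satisfies $S(A,\varepsilon)$ if the union of all open intervals $J$ for which $f$ satisfies $S(J,A,\varepsilon)$ is dense in $\mathbb{R}$. $\mathfrak{S}$ denotes the class of all functions with the Baire property that satisfy $S(A,\varepsilon)$ for all residual $A\subset\mathbb{R}$ and all $\varepsilon>0$. *)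

(* Defs.v *)
From Stdlib Require Import Reals Lra.
Open Scope R_scope.

Definition is_open (U : R -> Prop) : Prop :=
  forall x, U x -> exists d, d > 0 /\ forall y, Rabs (y - x) < d -> U y.

Definition closure (E : R -> Prop) (x : R) : Prop :=
  forall e, e > 0 -> exists y, E y /\ Rabs (y - x) < e.

Definition nowhere_dense (E : R -> Prop) : Prop :=
  ~ (exists x d, d > 0 /\ forall y, Rabs (y - x) < d -> closure E y).

Definition meager (E : R -> Prop) : Prop :=
  exists N : nat -> R -> Prop,
    (forall n, nowhere_dense (N n)) /\ (forall x, E x -> exists n, N n x).

Definition residual (A : R -> Prop) : Prop := meager (fun x => ~ A x).

Definition set_Baire (B : R -> Prop) : Prop :=
  exists U, is_open U /\ meager (fun x => (B x /\ ~ U x) \/ (U x /\ ~ B x)).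

Definition fun_Baire (f : R -> R) : Prop :=
  forall V, is_open V -> set_Baire (fun x => V (f x)).

Definition contpts (f : R -> R) (x : R) : Prop := continuity_pt f x.

Definition swiatkowski (f : R -> R) : Prop :=
  forall a b, a < b -> f a <> f b ->
    exists x, a < x < b /\ contpts f x /\
      Rmin (f a) (f b) < f x < Rmax (f a) (f b).

Definition Iab (a b x : R) : Prop := Rmin a b < x < Rmax a b.

Definition S_J (f : R -> R) (p q : R) (A : R -> Prop) (eps : R) : Prop :=
  forall a b, p < a < q -> p < b < q -> f a < f b ->
    exists x, A x /\ Iab a b x /\ f a - eps < f x < f b + eps.

(* S(A,eps): the union of all open intervals J with S(J,A,eps) is dense in R.
   (Open intervals are taken bounded, (p,q) with p<q; unbounded ones give
   the same union since S(J,A,eps) passes to subintervals.) *)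
Definition S_cond (f : R -> R) (A : R -> Prop) (eps : R) : Prop :=
  forall c d, c < d ->
    exists x, c < x < d /\ exists p q, p < x < q /\ S_J f p q A eps.

Definition classS (f : R -> R) : Prop :=
  fun_Baire f /\ forall A, residual A -> forall eps, eps > 0 -> S_cond f A eps.

(* Main.v *)
Require Import Defs.
From Stdlib Require Import Reals Lra Lia ZArith Classical IndefiniteDescription Cantor Ranalysis5.
Open Scope R_scope.

(** If [f] is the limit of [g n], the common continuity points of the [g n] form a residual
    set, so [f] is a limit of continuous functions there, and by Baire category the convergence
    is uniform up to [e] on a residual part of some interval; intermediate continuity points
    of the [g n] then move into any given residual set.

    Conversely, fix a residual [B] on which [f] has locally small oscillation and closed nowhere
    dense sets [E 0], [E 1], ... increasing to a set that contains the complement of [B], such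
    that on every component of the complement of [E n] the function [f] satisfies [S_J] and has
    oscillation on [B] at most [eps n]. The approximant [g n] equals [f] on [E n]; on a
    component it is continuous and takes, near each end, every value of an open set of values
    around those of [f] on [B]. This set has radius of order [eps k] if the component is within
    [eps n] of [E (S k)] but not of [E k], and is the whole line near [E 0]. A pair with a point
    outside [E n] is then handled by the oscillation at the end of a component, a pair in [E n] by [S_J];
    and a point of [B] outside all [E k] eventually leaves the neighbourhoods of each [E k]. *)

(** * The scales [eps n], least witnesses and dependent choice *)

Definition eps (n : nat) : R := / (INR n + 1).

Lemma eps_pos n : 0 < eps n.
Proof. apply Rinv_0_lt_compat. pose proof (pos_INR n). lra. Qed.

Lemma eps_decr n m : (n <= m)%nat -> eps m <= eps n.
Proof.
  intros H. apply Rinv_le_contravar.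
  - pose proof (pos_INR n). lra.
  - apply le_INR in H. lra.
Qed.

Lemma eps_small e : 0 < e -> exists n, eps n < e.
Proof.
  intros He.
  destruct (INR_archimed 1 (/ e) Rlt_0_1) as [n Hn].
  exists n. rewrite <- (Rinv_inv e). apply Rinv_lt_contravar.
  - apply Rmult_lt_0_compat; [now apply Rinv_0_lt_compat|].
    pose proof (pos_INR n). lra.
  - lra.
Qed.

Lemma Rabs_le_bounds x a : Rabs x <= a -> - a <= x <= a.
Proof. unfold Rabs. destruct (Rcase_abs x); lra. Qed.

Lemma least_witness (P : nat -> Prop) :
  (exists n, P n) -> exists n, P n /\ forall m, (m < n)%nat -> ~ P m.
Proof.
  intros [n Hn]. induction n as [n IH] using (well_founded_induction Nat.lt_wf_0).
  destruct (classic (exists m, (m < n)%nat /\ P m)) as [[m [Hm HP]]|H].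
  - now apply (IH m).
  - exists n. split; [exact Hn|]. intros m Hm HP. apply H. now exists m.
Qed.

(** The step relation is made total by an implication from [P], so that functional choice applies.
    The stage number enters the relation because the n-th step must deal with the n-th set of a
    sequence. *)
Lemma dependent_choice {A : Type} (P : A -> Prop) (S' : nat -> A -> A -> Prop) (a : A) :
  P a -> (forall n x, P x -> exists y, P y /\ S' n x y) ->
  exists s : nat -> A, s O = a /\ forall n, P (s n) /\ S' n (s n) (s (S n)).
Proof.
  intros Ha Hstep.
  destruct (functional_choice
    (fun (u : nat * A) y => P (snd u) -> P y /\ S' (fst u) (snd u) y)) as [F HF].
  { intros [n x]. simpl. destruct (classic (P x)) as [Hx|Hx].
    - destruct (Hstep n x Hx) as [y Hy]. now exists y.
    - exists x. tauto. }
  pose (s := fix s n := match n with O => a | S k => F (k, s k) end).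
  assert (Hs : forall n, P (s n)).
  { induction n as [|n IH]; [exact Ha|]. exact (proj1 (HF (n, s n) IH)). }
  exists s. split; [reflexivity|]. intros n. split; [apply Hs|].
  exact (proj2 (HF (n, s n) (Hs n))).
Qed.

(** * Baire category on the line *)

(** Nowhere density in the form that nested intervals consume: the avoiding interval is closed and
    strictly inside. *)
Definition sparse (E : R -> Prop) : Prop :=
  forall c d, c < d ->
    exists p q, c < p /\ p < q /\ q < d /\ forall x, p <= x <= q -> ~ E x.

Lemma nowhere_dense_sparse E : nowhere_dense E -> sparse E.
Proof.
  intros H c d Hcd. apply NNPP. intros Hn. apply H.
  exists ((c + d) / 2), ((d - c) / 2). split; [lra|].
  intros y Hy e He. apply Rabs_def2 in Hy.
  apply NNPP. intros Hy'. apply Hn.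
  pose (r := Rmin (e / 2) (Rmin ((d - y) / 2) ((y - c) / 2))).
  assert (Hr : 0 < r) by (repeat apply Rmin_glb_lt; lra).
  assert (r <= e / 2) by apply Rmin_l.
  assert (r <= (d - y) / 2) by (eapply Rle_trans; [apply Rmin_r|apply Rmin_l]).
  assert (r <= (y - c) / 2) by (eapply Rle_trans; [apply Rmin_r|apply Rmin_r]).
  exists (y - r), (y + r). repeat split; try lra.
  intros x Hx HE. apply Hy'. exists x. split; [exact HE|].
  apply Rabs_def1; lra.
Qed.

Lemma sparse_union E F : sparse E -> sparse F -> sparse (fun x => E x \/ F x).
Proof.
  intros HE HF c d Hcd.
  destruct (HE c d Hcd) as [p [q [H1 [H2 [H3 H4]]]]].
  destruct (HF p q H2) as [p' [q' [H5 [H6 [H7 H8]]]]].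
  exists p', q'. repeat split; try lra.
  intros x Hx [Hx'|Hx'].
  - apply (H4 x); [lra|exact Hx'].
  - now apply (H8 x).
Qed.

Lemma meager_sub E F : (forall x, E x -> F x) -> meager F -> meager E.
Proof. intros H [N [H1 H2]]. exists N. split; auto. Qed.

(** Cantor pairing turns the double sequence of nowhere dense sets into a single one. *)
Lemma meager_iUnion (M : nat -> R -> Prop) :
  (forall n, meager (M n)) -> meager (fun x => exists n, M n x).
Proof.
  intros H. apply functional_choice in H. destruct H as [N HN].
  exists (fun i => N (fst (of_nat i)) (snd (of_nat i))). split.
  - intros i. apply HN.
  - intros x [n Hn]. destruct (proj2 (HN n) x Hn) as [k Hk].
    exists (to_nat (n, k)). now rewrite cancel_of_to.
Qed.

Lemma meager_union E F : meager E -> meager F -> meager (fun x => E x \/ F x).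
Proof.
  intros HE HF.
  apply meager_sub with (fun x => exists n, (match n with O => E | _ => F end) x).
  - intros x [Hx|Hx]; [now exists O|now exists 1%nat].
  - apply meager_iUnion. now intros [|n].
Qed.

Lemma nowhere_dense_meager E : nowhere_dense E -> meager E.
Proof. intros H. exists (fun _ => E). split; [auto|]. intros x Hx. now exists O. Qed.

(** Baire category theorem: closed intervals are nested so that the n-th step avoids [N n], and the
    supremum of the left ends lies in all of them. *)
Lemma meager_codense E : meager E -> forall c d, c < d -> exists x, c < x < d /\ ~ E x.
Proof.
  intros [N [HN HE]] c d Hcd.
  destruct (dependent_choice (fun I : R * R => fst I < snd I)
    (fun n I I' => fst I < fst I' /\ snd I' < snd I /\
       forall x, fst I' <= x <= snd I' -> ~ N n x) (c, d) Hcd) as [s [Hs0 Hs]].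
  { intros n [a b] Hab. simpl in *.
    destruct (nowhere_dense_sparse _ (HN n) a b Hab) as [p [q [H1 [H2 [H3 H4]]]]].
    exists (p, q). simpl. auto. }
  assert (Hmono : forall n k, fst (s n) <= fst (s (k + n)%nat) /\ snd (s (k + n)%nat) <= snd (s n)).
  { intros n k. induction k as [|k IH]; simpl; [lra|].
    destruct (Hs (k + n)%nat) as [_ [H1 [H2 _]]]. lra. }
  assert (Hlt : forall n m, fst (s n) < snd (s m)).
  { intros n m. pose proof (Hmono n m) as H1. pose proof (Hmono m n) as H2.
    rewrite Nat.add_comm in H2. pose proof (proj1 (Hs (m + n)%nat)). lra. }
  destruct (completeness (fun y => exists n, y = fst (s n))) as [x [Hub Hlub]].
  { exists (snd (s O)). intros y [n ->]. apply Rlt_le, Hlt. }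
  { exists (fst (s O)). now exists O. }
  assert (Hx : forall n, fst (s n) <= x <= snd (s n)).
  { intros n. split.
    - apply Hub. now exists n.
    - apply Hlub. intros y [m ->]. apply Rlt_le, Hlt. }
  exists x. split.
  - destruct (Hs O) as [_ [H1 [H2 _]]]. pose proof (Hx 1%nat).
    rewrite Hs0 in H1, H2. simpl in H1, H2. lra.
  - intros Hx'. destruct (HE x Hx') as [n Hn].
    destruct (Hs n) as [_ [_ [_ H]]]. exact (H x (Hx (S n)) Hn).
Qed.

(** * Maximal dyadic intervals *)

Definition component (E : R -> Prop) (p q : R) : Prop :=
  p < q /\ E p /\ E q /\ forall x, p < x < q -> ~ E x.

Lemma INR_lt_pow2 n : INR n < 2 ^ n.
Proof.
  induction n as [|n IH]; [simpl; lra|].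
  rewrite S_INR. simpl. pose proof (pow_R1_Rle 2 n). lra.
Qed.

Lemma pow2_IZR n : 2 ^ n = IZR (2 ^ Z.of_nat n).
Proof. apply (pow_IZR 2 n). Qed.

Lemma pow2_pos n : 0 < 2 ^ n.
Proof. apply pow_lt. lra. Qed.

(** [E] is the complement of the union of the open good dyadic intervals of levels [i >= 0]. Open
    dyadic intervals are nested or disjoint, so a point off [E] lies in a largest good one, and its
    ends are in [E]. *)
Lemma dyadic_partition (good : R -> R -> Prop)
  (hered : forall p q p' q', good p q -> p <= p' -> p' < q' -> q' <= q -> good p' q')
  (dense : forall c d, c < d -> exists p q, c <= p /\ p < q /\ q <= d /\ good p q) :
  exists E, sparse E /\
    forall x, ~ E x -> exists p q, p < x < q /\ component E p q /\ good p q.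
Proof.
  pose (inD := fun i j x => IZR j < x * 2 ^ i < IZR (j + 1)).
  pose (gD := fun i j => good (IZR j / 2 ^ i) (IZR (j + 1) / 2 ^ i)).
  exists (fun x => forall i j, gD i j -> ~ inD i j x). split.
  - intros c d Hcd.
    destruct (dense c d Hcd) as [p [q [H1 [H2 [H3 H4]]]]].
    destruct (INR_archimed (q - p) 2) as [i Hi]; [lra|].
    pose proof (INR_lt_pow2 i) as Hp. pose proof (pow2_pos i) as Hp0.
    (* An interval longer than two grid steps contains a full cell, the one that starts at the first
       grid point beyond [p]. *)
    assert (Hw : 2 < (q - p) * 2 ^ i).
    { apply Rlt_trans with (INR i * (q - p)); [lra|].
      rewrite Rmult_comm. apply Rmult_lt_compat_l; lra. }
    destruct (archimed (p * 2 ^ i)) as [Ha Hb].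
    set (j := up (p * 2 ^ i)) in *.
    pose proof (plus_IZR j 1) as Hj.
    assert (Hl : p < IZR j / 2 ^ i).
    { apply Rmult_lt_reg_r with (2 ^ i); [lra|].
      replace (IZR j / 2 ^ i * 2 ^ i) with (IZR j) by (field; lra). lra. }
    assert (Hr : IZR (j + 1) / 2 ^ i < q).
    { apply Rmult_lt_reg_r with (2 ^ i); [lra|].
      replace (IZR (j + 1) / 2 ^ i * 2 ^ i) with (IZR (j + 1)) by (field; lra). lra. }
    pose proof (Rinv_0_lt_compat _ Hp0) as Hv.
    assert (Hm : IZR (j + 1) / 2 ^ i = IZR j / 2 ^ i + / 2 ^ i)
      by (rewrite Hj; field; lra).
    exists (IZR j / 2 ^ i + / 2 ^ i / 4), (IZR j / 2 ^ i + / 2 ^ i / 2).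
    repeat split; try lra.
    intros x Hx HE. apply (HE i j).
    + apply (hered p q); [exact H4|lra|lra|lra].
    + unfold inD. rewrite Hj. split; apply Rmult_lt_reg_r with (/ 2 ^ i); try exact Hv;
        replace (x * 2 ^ i * / 2 ^ i) with x by (field; lra); [unfold Rdiv in Hx; lra|].
      replace ((IZR j + 1) * / 2 ^ i) with (IZR j / 2 ^ i + / 2 ^ i) by (field; lra). lra.
  - intros x Hx.
    destruct (least_witness (fun i => exists j, gD i j /\ inD i j x)) as [i [[j [Hg HD]] Hmin]].
    { apply NNPP. intros H. apply Hx. intros i j Hg HD. apply H. now exists i, j. }
    pose proof (pow2_pos i) as Hp0.
    (* An end-point interior to another good dyadic interval would put [x] into a
       good interval of smaller level. *)
    assert (Hend : forall e : Z, (j <= e <= j + 1)%Z ->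
              forall i' j', gD i' j' -> ~ inD i' j' (IZR e / 2 ^ i)).
    { intros e He i' j' Hg' [H1 H2]. destruct (Nat.le_gt_cases i i') as [Hi|Hi].
      (* At an equal or finer level the end is itself a grid point, hence not interior to a cell. *)
      - replace (IZR e / 2 ^ i * 2 ^ i') with (IZR (e * 2 ^ Z.of_nat (i' - i))) in H1, H2.
        + apply lt_IZR in H1, H2. lia.
        + rewrite mult_IZR, <- pow2_IZR.
          replace i' with (i + (i' - i))%nat at 2 by lia.
          rewrite pow_add. field. lra.
      - apply (Hmin i' Hi). exists j'. split; [exact Hg'|].
        set (w := (2 ^ Z.of_nat (i - i'))%Z).
        assert (Hw : 2 ^ i = 2 ^ i' * IZR w).
        { unfold w. rewrite <- pow2_IZR, <- pow_add. f_equal. lia. }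
        pose proof (pow2_pos i') as Hp'.
        assert (Hw0 : 0 < IZR w) by (unfold w; rewrite <- pow2_IZR; apply pow2_pos).
        assert (He' : IZR e / 2 ^ i * 2 ^ i' * IZR w = IZR e).
        { rewrite Hw. field. lra. }
        apply (Rmult_lt_compat_r (IZR w)) in H1; [|exact Hw0].
        apply (Rmult_lt_compat_r (IZR w)) in H2; [|exact Hw0].
        rewrite He', <- mult_IZR in H1, H2. apply lt_IZR in H1, H2.
        assert (H3 : IZR (j' * w) <= IZR j) by (apply IZR_le; lia).
        assert (H4 : IZR (j + 1) <= IZR ((j' + 1) * w)) by (apply IZR_le; lia).
        rewrite mult_IZR in H3, H4. destruct HD as [H5 H6]. rewrite Hw in H5, H6.
        split; apply Rmult_lt_reg_r with (IZR w); lra. }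
    assert (Hin : forall y, IZR j / 2 ^ i < y < IZR (j + 1) / 2 ^ i <-> inD i j y).
    { intros y.
      replace y with (y * 2 ^ i / 2 ^ i) at 1 2 by (field; lra).
      pose proof (Rinv_0_lt_compat _ Hp0) as Hv. unfold Rdiv, inD. split.
      - intros [H1 H2]. apply Rmult_lt_reg_r in H1; [|exact Hv].
        apply Rmult_lt_reg_r in H2; [|exact Hv]. now split.
      - intros [H1 H2]. split; now apply Rmult_lt_compat_r. }
    apply Hin in HD as HD'.
    exists (IZR j / 2 ^ i), (IZR (j + 1) / 2 ^ i). repeat split; try lra.
    + apply Hend. lia.
    + apply Hend. lia.
    + intros y Hy HE. apply (HE i j Hg). now apply Hin.
    + exact Hg.
Qed.

(** * Limits of Swiatkowski functions *)

Lemma contpts_iff g x :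
  contpts g x <-> forall e, e > 0 -> exists d, d > 0 /\
    forall y, Rabs (y - x) < d -> Rabs (g y - g x) < e.
Proof.
  split; intros H e He; destruct (H e He) as [d [Hd Hy]]; exists d; (split; [exact Hd|]).
  - intros y Hyd. destruct (Req_dec x y) as [->|Hne].
    + rewrite Rminus_diag, Rabs_R0. exact He.
    + apply Hy. split; [now split|exact Hyd].
  - intros y [_ Hyd]. now apply Hy.
Qed.

(** An open condition on [x]; continuity at [x] amounts to this condition for all [e = eps n]. *)
Definition osc_lt (g : R -> R) (e x : R) : Prop :=
  exists d, d > 0 /\ forall y z, Rabs (y - x) < d -> Rabs (z - x) < d ->
    Rabs (g y - g z) < e.

Lemma contpts_osc_lt g x e : e > 0 -> contpts g x -> osc_lt g e x.
Proof.
  intros He H. destruct (proj1 (contpts_iff g x) H (e / 2)) as [d [Hd Hy]]; [lra|].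
  exists d. split; [exact Hd|]. intros y z H1 H2.
  apply Hy in H1, H2. apply Rabs_def2 in H1, H2. apply Rabs_def1; lra.
Qed.

(** Either two values inside the interval differ and the definition yields a point, or [g] is
    constant there. *)
Lemma swiatkowski_contpts_dense g c d :
  swiatkowski g -> c < d -> exists x, c < x < d /\ contpts g x.
Proof.
  intros Hg Hcd.
  destruct (classic (exists a b, c < a /\ a < b /\ b < d /\ g a <> g b))
    as [[a [b [H1 [H2 [H3 H4]]]]]|H].
  - destruct (Hg a b H2 H4) as [x [Hx [Hc _]]]. exists x. split; [lra|exact Hc].
  - assert (Hcst : forall a b, c < a < d -> c < b < d -> g a = g b).
    { intros a b Ha Hb. apply NNPP. intros Hne. apply H.
      destruct (Rtotal_order a b) as [Hl|[->|Hl]]; [|easy|].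
      - now exists a, b.
      - exists b, a. apply not_eq_sym in Hne. repeat split; tauto || lra. }
    exists ((c + d) / 2). split; [lra|]. apply contpts_iff. intros e He.
    exists ((d - c) / 2). split; [lra|]. intros y Hy. apply Rabs_def2 in Hy.
    rewrite (Hcst y ((c + d) / 2)) by lra. now rewrite Rminus_diag, Rabs_R0.
Qed.

(** The points where [osc_lt g (eps n)] fails form a nowhere dense set, since each of the densely
    many continuity points has a neighbourhood where it holds. *)
Lemma swiatkowski_contpts_residual g : swiatkowski g -> residual (contpts g).
Proof.
  intros Hg. exists (fun n x => ~ osc_lt g (eps n) x). split.
  - intros n [x [d [Hd Hcl]]].
    destruct (swiatkowski_contpts_dense g (x - d) (x + d) Hg) as [c [Hc Hcc]]; [lra|].
    destruct (contpts_osc_lt g c (eps n) (eps_pos n) Hcc) as [r [Hr Hosc]].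
    destruct (Hcl c) with (e := r / 2) as [y [Hy Hyc]]; [apply Rabs_def1; lra|lra|].
    apply Hy. apply Rabs_def2 in Hyc. exists (r / 2). split; [lra|].
    intros u v Hu Hv. apply Rabs_def2 in Hu, Hv. apply Hosc; apply Rabs_def1; lra.
  - intros x Hx. apply NNPP. intros Hn. apply Hx. apply contpts_iff. intros e He.
    destruct (eps_small e He) as [n Hne].
    assert (Ho : osc_lt g (eps n) x) by (apply NNPP; intros Ho; apply Hn; now exists n).
    destruct Ho as [d [Hd Hosc]]. exists d. split; [exact Hd|].
    intros y Hy. apply Rlt_trans with (eps n); [|exact Hne].
    apply Hosc; [exact Hy|]. now rewrite Rminus_diag, Rabs_R0.
Qed.

Lemma closure_closed E x d :
  (forall y, Rabs (y - x) < d -> closure (closure E) y) ->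
  forall y, Rabs (y - x) < d -> closure E y.
Proof.
  intros H y Hy e He. destruct (H y Hy (e / 2)) as [z [Hz Hzy]]; [lra|].
  destruct (Hz (e / 2)) as [w [Hw Hwz]]; [lra|].
  exists w. split; [exact Hw|]. apply Rabs_def2 in Hzy, Hwz. apply Rabs_def1; lra.
Qed.

Lemma closure_sub (E F : R -> Prop) x : (forall y, E y -> F y) -> closure E x -> closure F x.
Proof. intros H HE e He. destruct (HE e He) as [y [Hy Hyx]]. exists y. auto. Qed.

Definition interior (E : R -> Prop) (x : R) : Prop :=
  exists d, d > 0 /\ forall y, Rabs (y - x) < d -> E y.

Lemma interior_open E : is_open (interior E).
Proof.
  intros x [d [Hd H]]. exists (d / 2). split; [lra|].
  intros y Hy. exists (d / 2). split; [lra|]. intros z Hz. apply H.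
  apply Rabs_def2 in Hy, Hz. apply Rabs_def1; lra.
Qed.

Lemma boundary_nowhere_dense E :
  nowhere_dense (fun x => closure E x /\ ~ interior (closure E) x).
Proof.
  intros [x [d [Hd H]]].
  assert (Hcl : forall y, Rabs (y - x) < d -> closure E y).
  { apply closure_closed. intros y Hy. apply closure_sub with (2 := H y Hy). tauto. }
  destruct (H x) with (e := d / 2) as [y [[_ Hy] Hyx]];
    [now rewrite Rminus_diag, Rabs_R0|lra|].
  apply Hy. exists (d / 2). split; [lra|]. intros z Hz. apply Hcl.
  apply Rabs_def2 in Hyx, Hz. apply Rabs_def1; lra.
Qed.

Lemma swiatkowski_common_contpts (g : nat -> R -> R) :
  (forall n, swiatkowski (g n)) -> residual (fun x => forall n, contpts (g n) x).
Proof.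
  intros Hg. apply meager_sub with (fun x => exists n, ~ contpts (g n) x).
  - intros x Hx. now apply not_all_ex_not.
  - apply meager_iUnion. intros n. apply swiatkowski_contpts_residual, Hg.
Qed.

(** On the common continuity points the preimage of [V] is a countable union of relatively closed
    sets [T k N], and the closure of each differs from its interior by a nowhere dense boundary. *)
Lemma limit_fun_Baire (g : nat -> R -> R) f :
  residual (fun x => forall n, contpts (g n) x) ->
  (forall x, Un_cv (fun n => g n x) (f x)) -> fun_Baire f.
Proof.
  intros Hres Hlim V HV.
  set (D := fun x => forall n, contpts (g n) x) in *.
  (* The radius [eps k] is uniform in [n], so the limit [f x] still lies in [V]. *)
  pose (T := fun (k N : nat) x => D x /\ forall n, (n >= N)%nat ->
               forall y, Rabs (y - g n x) < eps k -> V y).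
  assert (HTV : forall k N x, T k N x -> V (f x)).
  { intros k N x [_ HT]. destruct (Hlim x (eps k) (eps_pos k)) as [M HM].
    apply (HT (max N M)); [lia|]. rewrite Rabs_minus_sym. apply HM. lia. }
  assert (HVT : forall x, D x -> V (f x) -> exists k N, T k N x).
  { intros x Hx HVx. destruct (HV _ HVx) as [d [Hd Hy]].
    destruct (eps_small (d / 2)) as [k Hk]; [lra|].
    destruct (Hlim x (d / 2)) as [N HN]; [lra|]. exists k, N. split; [exact Hx|].
    intros n Hn y Hyg. apply Hy. specialize (HN n Hn). unfold Rdist in HN.
    apply Rabs_def2 in HN, Hyg. apply Rabs_def1; lra. }
  assert (HTcl : forall k N x, D x -> closure (T k N) x -> T k N x).
  { intros k N x Hx Hcl. split; [exact Hx|]. intros n Hn y Hy.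
    (* Continuity of [g n] at [x] moves the centre of the ball by less than the distance that [y]
       keeps from its boundary. *)
    destruct (proj1 (contpts_iff _ _) (Hx n) (eps k - Rabs (y - g n x)))
      as [d [Hd Hc]]; [lra|].
    destruct (Hcl d Hd) as [z [[_ Hz] Hzx]]. apply (Hz n Hn).
    specialize (Hc z Hzx). rewrite Rabs_minus_sym in Hc.
    replace (y - g n z) with ((y - g n x) + (g n x - g n z)) by ring.
    eapply Rle_lt_trans; [apply Rabs_triang|]. lra. }
  exists (fun x => exists k N, interior (closure (T k N)) x). split.
  - intros x [k [N Hx]]. destruct (interior_open _ x Hx) as [d [Hd Hy]].
    exists d. split; [exact Hd|]. intros y Hyx. exists k, N. now apply Hy.
  - apply meager_sub with (fun x => ~ D x \/ exists k N,
      closure (T k N) x /\ ~ interior (closure (T k N)) x).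
    + intros x Hx. apply NNPP. intros Hn.
      assert (HD : D x) by (apply NNPP; tauto).
      destruct Hx as [[HVx HU]|[[k [N HU]] HVx]].
      * apply Hn. right. destruct (HVT x HD HVx) as [k [N HT]]. exists k, N. split.
        -- intros e He. exists x. split; [exact HT|]. now rewrite Rminus_diag, Rabs_R0.
        -- intros Hi. apply HU. now exists k, N.
      * apply HVx. apply (HTV k N), HTcl; [exact HD|].
        destruct HU as [d [Hd Hy]]. apply Hy. now rewrite Rminus_diag, Rabs_R0.
    + apply meager_union; [exact Hres|].
      apply meager_iUnion. intros k. apply meager_iUnion. intros N.
      apply nowhere_dense_meager, boundary_nowhere_dense.
Qed.

Lemma Un_cv_dist_le (u : nat -> R) l c e N :
  Un_cv u l -> (forall n, (n >= N)%nat -> Rabs (c - u n) <= e) -> Rabs (c - l) <= e.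
Proof.
  intros Hu H. apply Rle_plus_epsilon. intros d Hd.
  destruct (Hu d Hd) as [M HM].
  replace (c - l) with ((c - u (max N M)) + (u (max N M) - l)) by ring.
  eapply Rle_trans; [apply Rabs_triang|].
  apply Rplus_le_compat; [apply H; lia|]. apply Rlt_le, HM. lia.
Qed.

(** The sets [T N] cover the common continuity points in [(c, d)], so by Baire one of them is dense
    in some interval; continuity carries its Cauchy estimate to all common continuity points
    there. *)
Lemma limit_almost_uniform (g : nat -> R -> R) f :
  residual (fun x => forall n, contpts (g n) x) ->
  (forall x, Un_cv (fun n => g n x) (f x)) ->
  forall e c d, e > 0 -> c < d ->
    exists x, c < x < d /\ exists p q N, p < x < q /\
      forall z, p < z < q -> (forall n, contpts (g n) z) ->
        forall n, (n >= N)%nat -> Rabs (g n z - f z) <= e.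
Proof.
  intros Hres Hlim e c d He Hcd.
  set (D := fun x => forall n, contpts (g n) x) in *.
  pose (T := fun N x => c < x < d /\ D x /\ forall n m, (n >= N)%nat -> (m >= N)%nat ->
               Rabs (g n x - g m x) <= e).
  destruct (classic (forall N, nowhere_dense (T N))) as [Hnd|Hnd].
  { exfalso.
    destruct (meager_codense (fun x => ~ D x \/ exists N, T N x)) with c d
      as [x [Hx Hx']]; [|exact Hcd|].
    - apply meager_union; [exact Hres|]. apply meager_iUnion. intros N.
      apply nowhere_dense_meager, Hnd.
    - apply Hx'. right. destruct (Hlim x (e / 2)) as [N HN]; [lra|].
      exists N. split; [exact Hx|]. split; [apply NNPP; tauto|].
      intros n m Hn Hm. apply HN in Hn, Hm. unfold Rdist in Hn, Hm.
      apply Rabs_def2 in Hn, Hm. apply Rabs_le. lra. }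
  apply not_all_ex_not in Hnd. destruct Hnd as [N HN]. apply NNPP in HN.
  destruct HN as [x0 [r [Hr Hcl]]].
  destruct (Hcl x0) with (e := r) as [x [[Hx _] Hxx]];
    [now rewrite Rminus_diag, Rabs_R0|exact Hr|].
  exists x. split; [exact Hx|]. exists (x0 - r), (x0 + r), N.
  apply Rabs_def2 in Hxx. split; [lra|].
  intros z Hz HD n Hn.
  apply Un_cv_dist_le with (fun m => g m z) N; [apply Hlim|].
  intros m Hm. apply Rle_plus_epsilon. intros t Ht.
  (* With [n] and [m] fixed, a single point of [T N] close to [z] serves both functions. *)
  destruct (proj1 (contpts_iff _ _) (HD n) (t / 2)) as [d1 [Hd1 H1]]; [lra|].
  destruct (proj1 (contpts_iff _ _) (HD m) (t / 2)) as [d2 [Hd2 H2]]; [lra|].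
  destruct (Hcl z) with (e := Rmin d1 d2) as [y [[_ [_ Hy]] Hyz]];
    [apply Rabs_def1; lra|now apply Rmin_glb_lt|].
  specialize (Hy n m Hn Hm).
  specialize (H1 y (Rlt_le_trans _ _ _ Hyz (Rmin_l _ _))).
  specialize (H2 y (Rlt_le_trans _ _ _ Hyz (Rmin_r _ _))).
  apply Rabs_def2 in H1, H2. apply Rabs_le_bounds in Hy. apply Rabs_le. lra.
Qed.

Lemma swiatkowski_Iab g a b : swiatkowski g -> g a < g b ->
  exists x, Iab a b x /\ contpts g x /\ g a < g x < g b.
Proof.
  intros Hg Hab. unfold Iab.
  destruct (Rtotal_order a b) as [H|[->|H]]; [|lra|].
  - destruct (Hg a b H) as [x [Hx [Hc Hgx]]]; [lra|]. exists x.
    rewrite Rmin_left, Rmax_right in * by lra. auto.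
  - destruct (Hg b a H) as [x [Hx [Hc Hgx]]]; [lra|]. exists x.
    rewrite Rmin_right, Rmax_left in * by lra. auto.
Qed.

Lemma limit_S_cond (g : nat -> R -> R) f A e :
  (forall n, swiatkowski (g n)) -> (forall x, Un_cv (fun n => g n x) (f x)) ->
  residual A -> e > 0 -> S_cond f A e.
Proof.
  intros Hg Hlim HA He c d Hcd.
  pose proof (swiatkowski_common_contpts g Hg) as Hres.
  destruct (limit_almost_uniform g f Hres Hlim (e / 4) c d) as
    [x [Hx [p [q [N [Hpq Hunif]]]]]]; [lra|exact Hcd|].
  exists x. split; [exact Hx|]. exists p, q. split; [exact Hpq|].
  intros a b Ha Hb Hab.
  (* Half the gap ensures [g n a < g n b]; [e / 4] keeps the total error below [e]. *)
  pose (t := Rmin (e / 4) ((f b - f a) / 2)).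
  assert (Ht : 0 < t) by (apply Rmin_glb_lt; lra).
  assert (Ht1 : t <= e / 4) by apply Rmin_l.
  assert (Ht2 : t <= (f b - f a) / 2) by apply Rmin_r.
  destruct (Hlim a t Ht) as [Na Hna]. destruct (Hlim b t Ht) as [Nb Hnb].
  pose (n := max N (max Na Nb)).
  assert (Hna' := Hna n ltac:(lia)). assert (Hnb' := Hnb n ltac:(lia)).
  unfold Rdist in Hna', Hnb'. apply Rabs_def2 in Hna', Hnb'.
  destruct (swiatkowski_Iab (g n) a b (Hg n)) as [u [Hu [Hc Hgu]]]; [lra|].
  (* Near [u] the values of [g n] stay between [g n a] and [g n b], which leaves freedom to pick the
     point in a residual set. *)
  destruct (proj1 (contpts_iff _ _) Hc (Rmin (g n u - g n a) (g n b - g n u)))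
    as [r [Hr Hcr]]; [apply Rmin_glb_lt; lra|].
  unfold Iab in *.
  destruct (meager_codense (fun x => ~ A x \/ ~ forall n, contpts (g n) x))
    with (c := Rmax (Rmin a b) (u - r)) (d := Rmin (Rmax a b) (u + r))
    as [y [[Hy1 Hy2] Hy]].
  - now apply meager_union.
  - apply Rmax_lub_lt; apply Rmin_glb_lt; lra.
  - pose proof (Rmax_l (Rmin a b) (u - r)). pose proof (Rmax_r (Rmin a b) (u - r)).
    pose proof (Rmin_l (Rmax a b) (u + r)). pose proof (Rmin_r (Rmax a b) (u + r)).
    exists y. split; [apply NNPP; tauto|]. split; [lra|].
    assert (Hpy : p < y < q).
    { assert (p < Rmin a b) by (apply Rmin_glb_lt; lra).
      assert (Rmax a b < q) by (apply Rmax_lub_lt; lra). lra. }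
    assert (HD : forall n, contpts (g n) y) by (apply NNPP; tauto).
    specialize (Hunif y Hpy HD n ltac:(lia)). apply Rabs_le_bounds in Hunif.
    specialize (Hcr y ltac:(apply Rabs_def1; lra)). apply Rabs_def2 in Hcr.
    pose proof (Rmin_l (g n u - g n a) (g n b - g n u)).
    pose proof (Rmin_r (g n u - g n a) (g n b - g n u)). lra.
Qed.

(** * Exhausting sequences for functions of the class *)

(** Countably many intervals [V i] cover the line at every scale. The preimage of each is open up to
    a meager set, and [B] discards all these meager sets. *)
Lemma fun_Baire_small_osc f : fun_Baire f ->
  exists B, residual B /\
    forall e c d, e > 0 -> c < d ->
      exists p q, c <= p /\ p < q /\ q <= d /\
        forall x y, p < x < q -> p < y < q -> B x -> B y -> Rabs (f x - f y) <= e.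
Proof.
  intros Hf.
  (* The centres are all integer multiples of [eps n]; the integer is a difference of two naturals,
     so that the index is a triple of naturals. *)
  pose (V := fun (i : nat * (nat * nat)) y =>
    Rabs (y - (INR (fst (snd i)) - INR (snd (snd i))) * eps (fst i)) < eps (fst i)).
  assert (HV : forall i, is_open (V i)).
  { intros i y Hy. unfold V in *.
    exists (eps (fst i) - Rabs (y - (INR (fst (snd i)) - INR (snd (snd i))) * eps (fst i))).
    split; [lra|]. intros z Hz.
    replace (z - _) with ((z - y) + (y - (INR (fst (snd i)) - INR (snd (snd i))) * eps (fst i)))
      by ring.
    eapply Rle_lt_trans; [apply Rabs_triang|]. lra. }
  destruct (functional_choice _ (fun i => Hf (V i) (HV i))) as [U HU].
  pose (M := fun i x => (V i (f x) /\ ~ U i x) \/ (U i x /\ ~ V i (f x))).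
  assert (HB : meager (fun x => exists n a b, M (n, (a, b)) x)).
  { do 3 (apply meager_iUnion; intros ?). apply HU. }
  exists (fun x => ~ exists n a b, M (n, (a, b)) x). split.
  { apply meager_sub with (2 := HB). intros x. apply NNPP. }
  intros e c d He Hcd.
  destruct (eps_small (e / 2)) as [n Hn]; [lra|].
  destruct (meager_codense _ HB c d Hcd) as [z [Hz HzB]].
  assert (HVz : exists a b, V (n, (a, b)) (f z)).
  (* The integer part of [f z / eps n], split into its positive and negative parts. *)
  { pose (k := (up (f z / eps n) - 1)%Z).
    exists (Z.to_nat k), (Z.to_nat (- k)). unfold V. simpl.
    rewrite !INR_IZR_INZ, <- minus_IZR.
    replace (Z.of_nat (Z.to_nat k) - Z.of_nat (Z.to_nat (- k)))%Z with k by lia.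
    unfold k. rewrite minus_IZR. destruct (archimed (f z / eps n)) as [H1 H2].
    pose proof (eps_pos n) as Hp.
    replace (f z) with (f z / eps n * eps n) at 1 by (field; lra).
    rewrite <- Rmult_minus_distr_r, Rabs_mult, (Rabs_right (eps n)) by lra.
    apply Rlt_le_trans with (1 * eps n); [|lra]. apply Rmult_lt_compat_r; [exact Hp|].
    apply Rabs_def1; lra. }
  destruct HVz as [a [b HVz]].
  assert (HUz : U (n, (a, b)) z).
  { apply NNPP. intros H. apply HzB. exists n, a, b. now left. }
  destruct (proj1 (HU (n, (a, b))) z HUz) as [r [Hr Hball]].
  assert (Hfx : forall x, z - r < x < z + r ->
            ~ (exists n a b, M (n, (a, b)) x) -> V (n, (a, b)) (f x)).
  { intros x Hx HxB. apply NNPP. intros H. apply HxB. exists n, a, b. right.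
    split; [|exact H]. apply Hball. apply Rabs_def1; lra. }
  exists (Rmax c (z - r)), (Rmin d (z + r)).
  split; [apply Rmax_l|]. split; [apply Rmax_lub_lt; apply Rmin_glb_lt; lra|].
  split; [apply Rmin_l|].
  pose proof (Rmax_r c (z - r)). pose proof (Rmin_r d (z + r)).
  intros x y Hx Hy HxB HyB.
  apply Hfx in HxB; [|lra]. apply Hfx in HyB; [|lra]. unfold V in HxB, HyB. simpl in *.
  apply Rabs_def2 in HxB, HyB. apply Rabs_le. lra.
Qed.

(** All three conditions pass to subintervals, as [dyadic_partition] requires. The length bound
    serves the convergence of the approximants. *)
Definition good (f : R -> R) (B : R -> Prop) (e p q : R) : Prop :=
  q - p <= e /\ S_J f p q B e /\
  forall x y, p < x < q -> p < y < q -> B x -> B y -> Rabs (f x - f y) <= e.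

Lemma S_J_sub f B e p q p' q' : p <= p' -> q' <= q -> S_J f p q B e -> S_J f p' q' B e.
Proof. intros H1 H2 H a b Ha Hb. apply H; lra. Qed.

Lemma good_sub f B e p q p' q' :
  p <= p' -> q' <= q -> good f B e p q -> good f B e p' q'.
Proof.
  intros H1 H2 [H3 [H4 H5]]. split; [lra|]. split.
  - now apply (S_J_sub f B e p q).
  - intros x y Hx Hy. apply H5; lra.
Qed.

(** The last clause also makes each [E n] closed: a point outside lies in an open interval that
    misses it. *)
Definition exhaustion (f : R -> R) (B : R -> Prop) (E : nat -> R -> Prop) : Prop :=
  (forall c d, c < d -> exists x, c < x < d /\ B x) /\
  (forall n, sparse (E n)) /\
  (forall n x, E n x -> E (S n) x) /\
  (forall x, ~ B x -> exists n, E n x) /\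
  (forall n x, ~ E n x ->
     exists p q, p < x < q /\ component (E n) p q /\ good f B (eps n) p q).

(** At stage [n] the dyadic partition is applied to the intervals that are good at scale [eps n] and
    miss both the previous set and [N n]. *)
Lemma classS_exhaustion f : classS f -> exists B E, exhaustion f B E.
Proof.
  intros [Hf HS]. destruct (fun_Baire_small_osc f Hf) as [B [HB Hosc]].
  destruct (HB) as [N [HN HNB]].
  destruct (dependent_choice sparse (fun n F E => (forall x, F x \/ N n x -> E x) /\
     forall x, ~ E x -> exists p q, p < x < q /\ component E p q /\ good f B (eps n) p q)
     (fun _ => False)) as [s [_ Hs]].
  { intros c d Hcd. exists ((2 * c + d) / 3), ((c + 2 * d) / 3). repeat split; try lra. auto. }
  { intros n F HF.
    pose proof (sparse_union _ _ HF (nowhere_dense_sparse _ (HN n))) as HFN.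
    destruct (dyadic_partition (fun p q => good f B (eps n) p q /\
        forall x, p < x < q -> ~ (F x \/ N n x))) as [E [HE HEc]].
    - intros p q p' q' [H1 H2] Hp Hpq Hq. split.
      + now apply (good_sub f B (eps n) p q).
      + intros x Hx. apply H2. lra.
    - intros c d Hcd.
      destruct (HFN c d Hcd) as [c1 [d1 [H1 [H2 [H3 H4]]]]].
      destruct (Hosc (eps n) c1 d1 (eps_pos n) H2) as [c2 [d2 [H5 [H6 [H7 H8]]]]].
      destruct (HS B HB (eps n) (eps_pos n) c2 d2 H6) as [x [Hx [c3 [d3 [H9 H10]]]]].
      pose (p := Rmax (Rmax c2 c3) (x - eps n / 2)).
      pose (q := Rmin (Rmin d2 d3) (x + eps n / 2)).
      pose proof (eps_pos n).
      assert (p < q) by (repeat (apply Rmax_lub_lt || apply Rmin_glb_lt); lra).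
      assert (c2 <= p /\ c3 <= p /\ x - eps n / 2 <= p).
      { unfold p. pose proof (Rmax_l (Rmax c2 c3) (x - eps n / 2)).
        pose proof (Rmax_r (Rmax c2 c3) (x - eps n / 2)).
        pose proof (Rmax_l c2 c3). pose proof (Rmax_r c2 c3). lra. }
      assert (q <= d2 /\ q <= d3 /\ q <= x + eps n / 2).
      { unfold q. pose proof (Rmin_l (Rmin d2 d3) (x + eps n / 2)).
        pose proof (Rmin_r (Rmin d2 d3) (x + eps n / 2)).
        pose proof (Rmin_l d2 d3). pose proof (Rmin_r d2 d3). lra. }
      exists p, q. repeat split; try lra.
      + apply (S_J_sub f B (eps n) c3 d3); lra || exact H10.
      + intros y z Hy Hz. apply H8; lra.
      + intros y Hy. apply H4. lra.
    - exists E. split; [exact HE|]. split.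
      + intros x Hx. apply NNPP. intros HEx.
        destruct (HEc x HEx) as [p [q [Hpq [_ [_ H]]]]]. exact (H x Hpq Hx).
      + intros x Hx. destruct (HEc x Hx) as [p [q [Hpq [Hc [Hg _]]]]]. now exists p, q. }
  (* The shift drops the empty starting set and gives the set built at stage [n] the index [n]. *)
  exists B, (fun n => s (S n)). repeat split.
  - intros c d Hcd. destruct (meager_codense _ HB c d Hcd) as [x [Hx HxB]].
    exists x. split; [exact Hx|]. now apply NNPP.
  - intros n. apply Hs.
  - intros n x Hx. apply Hs. now left.
  - intros x Hx. destruct (HNB x Hx) as [n Hn]. exists n. apply Hs. now right.
  - intros n. apply Hs.
Qed.

(** * Oscillating functions *)

(** Containment of the values in [Y] will control convergence; attainment near both ends will supply
    intermediate values. *)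
Definition oscillates (phi : R -> R) (p q : R) (Y : R -> Prop) : Prop :=
  (forall x, p < x < q -> contpts phi x /\ Y (phi x)) /\
  forall y, Y y -> forall c, p < c < q ->
    (exists x, p < x < c /\ phi x = y) /\ (exists x, c < x < q /\ phi x = y).

Lemma IVT_Iab phi a b y :
  (forall x, Rmin a b <= x <= Rmax a b -> continuity_pt phi x) ->
  phi a < y < phi b -> exists x, Iab a b x /\ phi x = y.
Proof.
  intros Hc Hy. unfold Iab.
  destruct (Rtotal_order a b) as [H|[->|H]]; [|lra|].
  - rewrite Rmin_left, Rmax_right in * by lra.
    destruct (IVT_interv (fun x => phi x - y) a b) as [x [Hx Hxy]]; [|lra..|].
    { intros x Hx. apply continuity_pt_minus; [now apply Hc|].
      apply continuity_pt_const. now intros ? ?. }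
    exists x. split; [|lra]. destruct (Req_dec x a), (Req_dec x b); subst; lra.
  - rewrite Rmin_right, Rmax_left in * by lra.
    destruct (IVT_interv (fun x => y - phi x) b a) as [x [Hx Hxy]]; [|lra..|].
    { intros x Hx. apply continuity_pt_minus; [|now apply Hc].
      apply continuity_pt_const. now intros ? ?. }
    exists x. split; [|lra]. destruct (Req_dec x a), (Req_dec x b); subst; lra.
Qed.

(** The function is [sin (/ u) / u] with [u] vanishing at both ends, so its swings are unbounded in
    both directions near each of them. *)
Lemma oscillates_line p q : p < q -> exists phi, oscillates phi p q (fun _ => True).
Proof.
  intros Hpq.
  pose (u := fun x => (x - p) * (q - x)).
  pose (phi := fun x => / u x * sin (/ u x)).
  assert (Hu : forall x, p < x < q -> 0 < u x).
  { intros x Hx. apply Rmult_lt_0_compat; lra. }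
  assert (Huc : forall x, continuity_pt u x).
  { intros x. unfold u. reg. }
  assert (Hphi : forall x, p < x < q -> continuity_pt phi x).
  { intros x Hx. specialize (Hu x Hx).
    assert (Hi : continuity_pt (/ u)%F x) by (apply continuity_pt_inv; [apply Huc|lra]).
    apply (continuity_pt_mult (/ u)%F (comp sin (/ u)%F)); [exact Hi|].
    apply continuity_pt_comp; [exact Hi|apply continuity_sin]. }
  assert (Hinv : forall c v, p < c < q -> / u c < v -> exists x, p < x < c /\ / u x = v).
  { intros c v Hc Hv. pose proof (Hu c Hc) as Huc0.
    assert (0 < / u c) by now apply Rinv_0_lt_compat.
    destruct (IVT_Iab u p c (/ v)) as [x [Hx Hxv]].
    - intros x _. apply Huc.
    - replace (u p) with 0 by (unfold u; ring). split; [apply Rinv_0_lt_compat; lra|].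
      rewrite <- (Rinv_inv (u c)). apply Rinv_lt_contravar; [|exact Hv].
      apply Rmult_lt_0_compat; lra.
    - exists x. unfold Iab in Hx. rewrite Rmin_left, Rmax_right in Hx by lra.
      split; [exact Hx|]. now rewrite Hxv, Rinv_inv. }
  assert (Hleft : forall y c, p < c < q -> exists x, p < x < c /\ phi x = y).
  { intros y c Hc.
    (* A large [k] puts the crest and the trough both to the left of [c] and beyond [y] in
       height. *)
    destruct (INR_archimed 1 (Rmax (/ u c) (Rabs y)) Rlt_0_1) as [k Hk].
    pose proof (Rmax_l (/ u c) (Rabs y)). pose proof (Rmax_r (/ u c) (Rabs y)).
    pose proof PI2_1 as HPI. pose proof (pos_INR k) as Hk0.
    assert (Hk2 : INR k <= 2 * INR k * PI).
    { apply Rle_trans with (2 * INR k * 1); [lra|]. apply Rmult_le_compat_l; lra. }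
    destruct (Hinv c (PI / 2 + 2 * INR k * PI) Hc) as [x1 [Hx1 Hs1]]; [lra|].
    destruct (Hinv c (3 * (PI / 2) + 2 * INR k * PI) Hc) as [x2 [Hx2 Hs2]]; [lra|].
    assert (Hp1 : phi x1 = PI / 2 + 2 * INR k * PI).
    { unfold phi. rewrite Hs1, sin_period, sin_PI2. ring. }
    assert (Hp2 : phi x2 = - (3 * (PI / 2) + 2 * INR k * PI)).
    { unfold phi. rewrite Hs2, sin_period, sin_3PI2. ring. }
    destruct (Rabs_le_bounds y (Rabs y) (Rle_refl _)) as [Hy1 Hy2].
    destruct (IVT_Iab phi x2 x1 y) as [x [Hx Hxy]].
    - intros x Hx. apply Hphi. revert Hx. unfold Rmin, Rmax.
      destruct (Rle_dec x2 x1); lra.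
    - lra.
    - exists x. split; [|exact Hxy]. revert Hx. unfold Iab, Rmin, Rmax.
      destruct (Rle_dec x2 x1); lra. }
  exists phi. split.
  - intros x Hx. split; [now apply Hphi|exact I].
  - intros y _ c Hc. split; [now apply Hleft|].
    (* Reflection in the midpoint preserves [u] and exchanges the two ends. *)
    destruct (Hleft y (p + q - c)) as [x [Hx Hxy]]; [lra|].
    exists (p + q - x). split; [lra|]. rewrite <- Hxy. unfold phi.
    replace (u (p + q - x)) with (u x) by (unfold u; ring). reflexivity.
Qed.

(** A scaled arctangent squeezes the line onto the ball. *)
Lemma oscillates_ball p q m r : p < q -> 0 < r ->
  exists phi, oscillates phi p q (fun y => Rabs (y - m) < r).
Proof.
  intros Hpq Hr. destruct (oscillates_line p q Hpq) as [psi [H1 H2]].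
  pose proof PI_RGT_0 as HPI.
  exists (fun x => m + r / (PI / 2) * atan (psi x)). split.
  - intros x Hx. split.
    + apply continuity_pt_plus; [apply continuity_pt_const; now intros ? ?|].
      apply continuity_pt_mult; [apply continuity_pt_const; now intros ? ?|].
      apply (continuity_pt_comp psi atan); [now apply H1|].
      apply derivable_continuous_pt, derivable_pt_atan.
    + destruct (atan_bound (psi x)) as [Ha Hb].
      replace (m + r / (PI / 2) * atan (psi x) - m)
        with (r * (atan (psi x) / (PI / 2))) by (field; lra).
      rewrite Rabs_mult, (Rabs_right r) by lra. rewrite <- (Rmult_1_r r) at 2.
      apply Rmult_lt_compat_l; [exact Hr|].
      apply Rabs_def1; apply Rmult_lt_reg_r with (PI / 2); try lra;
        replace (atan (psi x) / (PI / 2) * (PI / 2)) with (atan (psi x)) by (field; lra); lra.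
  - intros y Hy c Hc.
    assert (Ht : - (PI / 2) < (y - m) / r * (PI / 2) < PI / 2).
    { apply Rabs_def2 in Hy.
      assert (- 1 < (y - m) / r < 1).
      { split; apply Rmult_lt_reg_r with r; try lra;
          replace ((y - m) / r * r) with (y - m) by (field; lra); lra. }
      split; [replace (- (PI / 2)) with (- 1 * (PI / 2)) by field
             |replace (PI / 2) with (1 * (PI / 2)) at 2 by field];
        apply Rmult_lt_compat_r; lra. }
    assert (Hv : forall x, psi x = tan ((y - m) / r * (PI / 2)) ->
              m + r / (PI / 2) * atan (psi x) = y).
    { intros x ->. rewrite atan_tan by exact Ht. field. lra. }
    destruct (H2 (tan ((y - m) / r * (PI / 2))) I c Hc) as [[x1 [Hx1 E1]] [x2 [Hx2 E2]]].
    split; [exists x1|exists x2]; split; auto.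
Qed.

Lemma oscillates_ext phi g p q Y :
  (forall x, p < x < q -> g x = phi x) -> oscillates phi p q Y -> oscillates g p q Y.
Proof.
  intros Heq [H1 H2]. split.
  - intros x Hx. destruct (H1 x Hx) as [Hc HY]. split; [|now rewrite Heq].
    apply contpts_iff. intros e He. destruct (proj1 (contpts_iff _ _) Hc e He) as [d [Hd Hy]].
    exists (Rmin d (Rmin (x - p) (q - x))).
    split; [repeat apply Rmin_glb_lt; lra|]. intros y Hyx.
    pose proof (Rmin_l d (Rmin (x - p) (q - x))).
    pose proof (Rmin_r d (Rmin (x - p) (q - x))).
    pose proof (Rmin_l (x - p) (q - x)). pose proof (Rmin_r (x - p) (q - x)).
    rewrite (Heq x Hx), Heq.
    + apply Hy. lra.
    + apply Rabs_def2 in Hyx. lra.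
  - intros y Hy c Hc. destruct (H2 y Hy c Hc) as [[x1 [Hx1 E1]] [x2 [Hx2 E2]]].
    split; [exists x1|exists x2]; (split; [assumption|]); rewrite Heq; lra.
Qed.

Lemma open_between Y v w : is_open Y -> Y v -> v <> w ->
  exists y, Y y /\ Rmin v w < y < Rmax v w.
Proof.
  intros HY Hv Hne. destruct (HY v Hv) as [d [Hd H]].
  destruct (Rtotal_order v w) as [Hl|[->|Hl]]; [|easy|].
  - rewrite Rmin_left, Rmax_right by lra.
    pose proof (Rmin_l d (w - v)). pose proof (Rmin_r d (w - v)).
    assert (0 < Rmin d (w - v)) by (apply Rmin_glb_lt; lra).
    exists (v + Rmin d (w - v) / 2). split; [|lra]. apply H. apply Rabs_def1; lra.
  - rewrite Rmin_right, Rmax_left by lra.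
    pose proof (Rmin_l d (v - w)). pose proof (Rmin_r d (v - w)).
    assert (0 < Rmin d (v - w)) by (apply Rmin_glb_lt; lra).
    exists (v - Rmin d (v - w) / 2). split; [|lra]. apply H. apply Rabs_def1; lra.
Qed.

(* If [b] lies in a component not containing [a], the end of that component facing [a]
   already yields every value close to [g b]; so only pairs in [E] need attention. *)
Lemma swiatkowski_of_oscillates (E : R -> Prop) g :
  (forall x, ~ E x -> exists p q Y, p < x < q /\ component E p q /\
     is_open Y /\ oscillates g p q Y) ->
  (forall a b, a < b -> E a -> E b -> g a <> g b ->
     exists x, a < x < b /\ ~ E x /\ Rmin (g a) (g b) < g x < Rmax (g a) (g b)) ->
  swiatkowski g.
Proof.
  intros Hc HE a b Hab Hne.
  assert (Hcont : forall x, ~ E x -> contpts g x).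
  { intros x Hx. destruct (Hc x Hx) as [p [q [Y [Hpq [_ [_ [H _]]]]]]]. now apply H. }
  (* Two points of one component: the mean of the two values is attained between them by
     continuity. *)
  assert (Hsame : forall p q, p <= a -> b <= q -> (forall x, p < x < q -> ~ E x) ->
            ~ E a -> ~ E b -> exists x, a < x < b /\ contpts g x /\
              Rmin (g a) (g b) < g x < Rmax (g a) (g b)).
  { intros p q Hp Hq H Ha Hb.
    assert (Hcab : forall x, a <= x <= b -> contpts g x).
    { intros x Hx. apply Hcont. destruct (Req_dec x a) as [->|]; [exact Ha|].
      destruct (Req_dec x b) as [->|]; [exact Hb|]. apply H. lra. }
    destruct (Rtotal_order (g a) (g b)) as [Hl|[He|Hl]]; [|easy|].
    - destruct (IVT_Iab g a b ((g a + g b) / 2)) as [x [Hx Hgx]]; [|lra|].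
      + intros x. rewrite Rmin_left, Rmax_right by lra. apply Hcab.
      + unfold Iab in Hx. rewrite Rmin_left, Rmax_right in Hx by lra.
        exists x. split; [exact Hx|]. split; [apply Hcab; lra|].
        rewrite Rmin_left, Rmax_right by lra. lra.
    - destruct (IVT_Iab g b a ((g a + g b) / 2)) as [x [Hx Hgx]]; [|lra|].
      + intros x. rewrite Rmin_right, Rmax_left by lra. apply Hcab.
      + unfold Iab in Hx. rewrite Rmin_right, Rmax_left in Hx by lra.
        exists x. split; [exact Hx|]. split; [apply Hcab; lra|].
        rewrite Rmin_right, Rmax_left by lra. lra. }
  destruct (classic (E b)) as [Hb|Hb].
  - destruct (classic (E a)) as [Ha|Ha].
    + destruct (HE a b Hab Ha Hb Hne) as [x [Hx [HxE Hgx]]]. exists x.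
      split; [exact Hx|]. split; [now apply Hcont|exact Hgx].
    + destruct (Hc a Ha) as [p [q [Y [Hpq [[_ [_ [_ HnE]]] [HYo [Hosc1 Hosc2]]]]]]].
      assert (q <= b).
      { apply Rnot_lt_le. intros Hbq. apply (HnE b); [lra|exact Hb]. }
      destruct (open_between Y (g a) (g b) HYo (proj2 (Hosc1 a Hpq)) Hne) as [y [HYy Hy]].
      destruct (proj2 (Hosc2 y HYy a Hpq)) as [x [Hx Hgx]]. exists x.
      split; [lra|]. split; [apply Hosc1; lra|]. now rewrite Hgx.
  - destruct (Hc b Hb) as [p [q [Y [Hpq [[_ [_ [_ HnE]]] [HYo [Hosc1 Hosc2]]]]]]].
    destruct (Rle_lt_dec a p) as [Hap|Hpa].
    + destruct (open_between Y (g b) (g a) HYo (proj2 (Hosc1 b Hpq)) (not_eq_sym Hne))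
        as [y [HYy Hy]].
      destruct (proj1 (Hosc2 y HYy b Hpq)) as [x [Hx Hgx]]. exists x.
      split; [lra|]. split; [apply Hosc1; lra|].
      rewrite Hgx, Rmin_comm, Rmax_comm. exact Hy.
    + apply (Hsame p q); try lra; auto. apply HnE. lra.
Qed.

(** * Approximation by Swiatkowski functions *)

Lemma component_unique E p q p' q' x :
  component E p q -> component E p' q' -> p < x < q -> p' < x < q' -> p = p' /\ q = q'.
Proof.
  intros [_ [Hp [Hq H]]] [_ [Hp' [Hq' H']]] Hx Hx'. split.
  - destruct (Rtotal_order p p') as [Hl|[He|Hl]]; [|exact He|]; exfalso.
    + apply (H p'); [lra|exact Hp'].
    + apply (H' p); [lra|exact Hp].
  - destruct (Rtotal_order q q') as [Hl|[He|Hl]]; [|exact He|]; exfalso.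
    + apply (H' q); [lra|exact Hq].
    + apply (H q'); [lra|exact Hq'].
Qed.

(** Components are disjoint from [E] and from each other, so the prescriptions never conflict; [f]
    is the default value. *)
Lemma glue_on_components E f (Phi : R * R -> R -> R) :
  exists g, (forall x, E x -> g x = f x) /\
    forall p q, component E p q -> forall x, p < x < q -> g x = Phi (p, q) x.
Proof.
  destruct (functional_choice (fun x y => (E x -> y = f x) /\
    forall p q, component E p q -> p < x < q -> y = Phi (p, q) x)) as [g Hg].
  - intros x. destruct (classic (exists p q, component E p q /\ p < x < q))
      as [[p [q [Hc Hx]]]|Hn].
    + exists (Phi (p, q) x). split.
      * intros HE. exfalso. now apply (proj2 (proj2 (proj2 Hc)) x).
      * intros p' q' Hc' Hx'.
        now destruct (component_unique E p q p' q' x Hc Hc' Hx Hx') as [-> ->].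
    + exists (f x). split; [easy|]. intros p q Hc Hx. exfalso. apply Hn. now exists p, q.
  - exists g. split; [apply Hg|]. intros p q Hc x Hx. now apply Hg.
Qed.

Definition near (E : R -> Prop) (e p q : R) : Prop := exists x, E x /\ p - e < x < q + e.

(** Values of [f] on [B] in [(P, Q)] are within [eps k] of [f z], so radius [2 * eps k] makes the
    ball contain the [eps k]-neighbourhood of each of them. *)
Definition value_set (f : R -> R) (B : R -> Prop) (E : nat -> R -> Prop) (n : nat)
    (p q : R) (Y : R -> Prop) : Prop :=
  (near (E O) (eps n) p q /\ Y = fun _ => True) \/
  exists k P Q z, ~ near (E k) (eps n) p q /\ near (E (S k)) (eps n) p q /\
    component (E k) P Q /\ good f B (eps k) P Q /\ P < p /\ q < Q /\
    P < z < Q /\ B z /\ Y = fun y => Rabs (y - f z) < 2 * eps k.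

Lemma value_set_open f B E n p q Y : value_set f B E n p q Y -> is_open Y.
Proof.
  intros [[_ ->]|[k [P [Q [z [_ [_ [_ [_ [_ [_ [_ [_ ->]]]]]]]]]]]]].
  - intros x _. exists 1. split; [lra|auto].
  - intros x Hx. exists (2 * eps k - Rabs (x - f z)). split; [lra|].
    intros y Hy. replace (y - f z) with ((y - x) + (x - f z)) by ring.
    eapply Rle_lt_trans; [apply Rabs_triang|]. lra.
Qed.

(** Take the least level that is near the component; level [n] qualifies through [p]. If it is
    [S k], the midpoint lies in a component of the complement of [E k], whose ends are not near and
    so lie beyond [p] and [q]. *)
Lemma value_set_exists f B E n p q : exhaustion f B E -> component (E n) p q ->
  exists Y, value_set f B E n p q Y.
Proof.
  intros [HB [_ [_ [_ HE]]]] [Hpq [Hp _]]. pose proof (eps_pos n) as Hn.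
  destruct (least_witness (fun k => near (E k) (eps n) p q)) as [[|k] [Hk Hmin]].
  - exists n, p. split; [exact Hp|lra].
  - exists (fun _ => True). now left.
  - assert (Hfar : ~ near (E k) (eps n) p q) by (apply Hmin; lia).
    destruct (HE k ((p + q) / 2)) as [P [Q [HPQ [Hc Hg]]]].
    { intros H. apply Hfar. exists ((p + q) / 2). split; [exact H|lra]. }
    destruct (HB P Q) as [z [Hz HzB]]; [lra|].
    exists (fun y => Rabs (y - f z) < 2 * eps k). right. exists k, P, Q, z.
    destruct (Hc) as [_ [HP [HQ _]]].
    repeat (split; [assumption|]). split; [|split; [|auto]].
    + apply Rnot_le_lt. intros H. apply Hfar. exists P. split; [exact HP|lra].
    + apply Rnot_le_lt. intros H. apply Hfar. exists Q. split; [exact HQ|lra].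
Qed.

Lemma value_set_oscillates f B E n p q Y : p < q -> value_set f B E n p q Y ->
  exists phi, oscillates phi p q Y.
Proof.
  intros Hpq [[_ ->]|[k [P [Q [z [_ [_ [_ [_ [_ [_ [_ [_ ->]]]]]]]]]]]]].
  - now apply oscillates_line.
  - apply oscillates_ball; [exact Hpq|]. pose proof (eps_pos k). lra.
Qed.

Lemma approximant_exists f B E n : exhaustion f B E ->
  exists g, (forall x, E n x -> g x = f x) /\
    forall p q, component (E n) p q ->
      exists Y, value_set f B E n p q Y /\ oscillates g p q Y.
Proof.
  intros HE.
  destruct (functional_choice (fun (I : R * R) phi =>
    component (E n) (fst I) (snd I) ->
    exists Y, value_set f B E n (fst I) (snd I) Y /\ oscillates phi (fst I) (snd I) Y))
    as [Phi HPhi].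
  { intros [p q]. simpl. destruct (classic (component (E n) p q)) as [Hc|Hc].
    - destruct (value_set_exists f B E n p q HE Hc) as [Y HY].
      destruct (value_set_oscillates f B E n p q Y (proj1 Hc) HY) as [phi Hphi].
      exists phi. intros _. now exists Y.
    - now exists f. }
  destruct (glue_on_components (E n) f Phi) as [g [Hg1 Hg2]].
  exists g. split; [exact Hg1|]. intros p q Hc.
  destruct (HPhi (p, q) Hc) as [Y [HY Hosc]]. exists Y. split; [exact HY|].
  now apply (oscillates_ext (Phi (p, q))); [apply Hg2|].
Qed.

Lemma exhaustion_mono f B E : exhaustion f B E ->
  forall k n x, (k <= n)%nat -> E k x -> E n x.
Proof. intros [_ [_ [Hm _]]] k n x Hkn Hx. induction Hkn; auto. Qed.

Lemma component_inside E p q x a b : component E p q -> p < x < q -> E a -> E b ->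
  a < x < b -> a <= p /\ q <= b.
Proof.
  intros [_ [_ [_ H]]] Hx Ha Hb Hab.
  split; apply Rnot_lt_le; intros Hl; [apply (H a)|apply (H b)]; auto; lra.
Qed.

(** Sparseness gives a point off [E n] within [eps n] of [e] and between [a] and [b]; its component
    cannot pass [a] or [b]. *)
Lemma near_component_between f B E n a b e : exhaustion f B E -> a < b ->
  E n a -> E n b -> a <= e <= b ->
  exists p q, component (E n) p q /\ a <= p /\ q <= b /\ p - eps n < e < q + eps n.
Proof.
  intros [_ [Hsp [_ [_ HE]]]] Hab Ha Hb He. pose proof (eps_pos n) as Hn.
  destruct (Hsp n (Rmax a (e - eps n)) (Rmin b (e + eps n))) as [x [y [H1 [H2 [H3 H4]]]]].
  { apply Rmax_lub_lt; apply Rmin_glb_lt; lra. }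
  pose proof (Rmax_l a (e - eps n)). pose proof (Rmax_r a (e - eps n)).
  pose proof (Rmin_l b (e + eps n)). pose proof (Rmin_r b (e + eps n)).
  destruct (HE n x) as [p [q [Hpq [Hc _]]]]; [apply H4; lra|].
  destruct (component_inside (E n) p q x a b Hc Hpq Ha Hb) as [Hap Hqb]; [lra|].
  exists p, q. split; [exact Hc|]. split; [exact Hap|]. split; [exact Hqb|]. lra.
Qed.

(* Take the first [E l] meeting [[a, b]] and a component close to a point of [E l]: its level
   [k] is below [l], so [a] and [b] lie in one component of the complement of [E k], where
   [S_J] provides a value between [f a] and [f b]. *)
Lemma value_set_between f B E n a b u v : exhaustion f B E -> a < b ->
  E n a -> E n b -> u < v -> (f a = u /\ f b = v \/ f a = v /\ f b = u) ->
  exists p q, component (E n) p q /\ a <= p /\ q <= b /\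
    forall Y, value_set f B E n p q Y -> exists y, Y y /\ u < y < v.
Proof.
  intros HE Hab Ha Hb Huv Hf.
  destruct (least_witness (fun k => exists e, E k e /\ a <= e <= b))
    as [l [[e [Hel He]] Hmin]].
  { exists n, a. split; [exact Ha|lra]. }
  destruct (near_component_between f B E n a b e HE Hab Ha Hb He)
    as [p [q [Hc [Hap [Hqb Hpe]]]]].
  exists p, q. split; [exact Hc|]. split; [exact Hap|]. split; [exact Hqb|].
  intros Y [[_ ->]|[k [P [Q [z [Hfar [_ [HPQ [Hg [HPp [HqQ [Hz [HzB ->]]]]]]]]]]]]].
  { exists ((u + v) / 2). split; [exact I|lra]. }
  assert (Hkl : (k < l)%nat).
  { apply Nat.nle_gt. intros Hlk. apply Hfar. exists e. split; [|exact Hpe].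
    now apply (exhaustion_mono f B E HE l). }
  destruct HPQ as [_ [HP [HQ _]]]. destruct (Hc) as [Hpq _].
  assert (HaP : P < a).
  { apply Rnot_le_lt. intros H. apply (Hmin k Hkl). exists P. split; [exact HP|lra]. }
  assert (HbQ : b < Q).
  { apply Rnot_le_lt. intros H. apply (Hmin k Hkl). exists Q. split; [exact HQ|lra]. }
  destruct Hg as [_ [HS Hosc]].
  assert (Hx : exists x, B x /\ a < x < b /\ u - eps k < f x < v + eps k).
  { unfold S_J, Iab in HS. destruct Hf as [[Hfa Hfb]|[Hfa Hfb]].
    - destruct (HS a b) as [x [HxB Hx]]; [lra..|].
      rewrite Rmin_left, Rmax_right in Hx by lra. exists x. split; [exact HxB|lra].
    - destruct (HS b a) as [x [HxB Hx]]; [lra..|].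
      rewrite Rmin_right, Rmax_left in Hx by lra. exists x. split; [exact HxB|lra]. }
  destruct Hx as [x [HxB [Hx Hfx]]].
  assert (Hd : Rabs (f x - f z) <= eps k) by (apply Hosc; auto; lra).
  apply Rabs_le_bounds in Hd.
  (* The intervals [(u, v)] and [(f x - eps k, f x + eps k)] overlap; the midpoint of the overlap is
     taken. *)
  assert (Hy : exists y, u < y < v /\ f x - eps k < y < f x + eps k).
  { exists ((Rmax u (f x - eps k) + Rmin v (f x + eps k)) / 2).
    assert (Rmax u (f x - eps k) < Rmin v (f x + eps k)).
    { pose proof (eps_pos k). apply Rmax_lub_lt; apply Rmin_glb_lt; lra. }
    pose proof (Rmax_l u (f x - eps k)). pose proof (Rmax_r u (f x - eps k)).
    pose proof (Rmin_l v (f x + eps k)). pose proof (Rmin_r v (f x + eps k)). lra. }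
  destruct Hy as [y [Hy1 Hy2]]. exists y. split; [|exact Hy1]. apply Rabs_def1; lra.
Qed.

Lemma approximant_swiatkowski f B E n g : exhaustion f B E ->
  (forall x, E n x -> g x = f x) ->
  (forall p q, component (E n) p q -> exists Y, value_set f B E n p q Y /\ oscillates g p q Y) ->
  swiatkowski g.
Proof.
  intros HE Hgf Hg. apply (swiatkowski_of_oscillates (E n)).
  - intros x Hx. destruct HE as [_ [_ [_ [_ HE]]]].
    destruct (HE n x Hx) as [p [q [Hpq [Hc _]]]]. destruct (Hg p q Hc) as [Y [HY Hosc]].
    exists p, q, Y. split; [exact Hpq|]. split; [exact Hc|]. split; [|exact Hosc].
    exact (value_set_open f B E n p q Y HY).
  - intros a b Hab Ha Hb Hne. rewrite (Hgf a Ha), (Hgf b Hb) in *.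
    destruct (value_set_between f B E n a b (Rmin (f a) (f b)) (Rmax (f a) (f b)) HE Hab Ha Hb)
      as [p [q [Hc [Hap [Hqb Hval]]]]].
    + apply Rdichotomy in Hne. unfold Rmin, Rmax. destruct (Rle_dec (f a) (f b)); lra.
    + unfold Rmin, Rmax. destruct (Rle_dec (f a) (f b)); auto.
    + destruct (Hg p q Hc) as [Y [HY [_ Hosc]]]. destruct (Hc) as [Hpq [_ [_ HnE]]].
      destruct (Hval Y HY) as [y [HYy Hy]].
      destruct (Hosc y HYy ((p + q) / 2)) as [[x [Hx Hxy]] _]; [lra|].
      exists x. split; [lra|]. split; [apply HnE; lra|]. now rewrite Hxy.
Qed.

(** On the union of the [E m] the sequence is eventually constant. At any other point, for large
    [n], the component around [x] is far from [E K], which forces [k >= K]; then [g n x] and [f x]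
    are within [2 * eps k] and [eps k] of the same [f z]. *)
Lemma approximant_cv f B E (g : nat -> R -> R) : exhaustion f B E ->
  (forall n x, E n x -> g n x = f x) ->
  (forall n p q, component (E n) p q ->
     exists Y, value_set f B E n p q Y /\ oscillates (g n) p q Y) ->
  forall x, Un_cv (fun n => g n x) (f x).
Proof.
  intros HE Hgf Hg x e He. destruct (HE) as [_ [_ [_ [Hcov Hcomp]]]].
  destruct (classic (exists m, E m x)) as [[m Hm]|Hnone].
  { exists m. intros n Hn. rewrite (Hgf n x).
    - unfold Rdist. now rewrite Rminus_diag, Rabs_R0.
    - now apply (exhaustion_mono f B E HE m). }
  assert (Hno : forall n, ~ E n x) by (intros n Hn; apply Hnone; now exists n).
  assert (HxB : B x) by (apply NNPP; intros H; apply Hnone; now apply Hcov).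
  destruct (eps_small (e / 3)) as [K HK]; [lra|].
  destruct (Hcomp K x (Hno K)) as [P [Q [HPQ [[_ [_ [_ HnE]]] _]]]].
  (* A point near the component of [x] is within [2 * eps n] of [x]: one [eps n] for the length, one
     for the margin. *)
  destruct (eps_small (Rmin (x - P) (Q - x) / 2)) as [N HN].
  { assert (0 < Rmin (x - P) (Q - x)) by (apply Rmin_glb_lt; lra). lra. }
  pose proof (Rmin_l (x - P) (Q - x)). pose proof (Rmin_r (x - P) (Q - x)).
  exists N. intros n Hn. pose proof (eps_decr N n Hn) as HnN.
  destruct (Hcomp n x (Hno n)) as [p [q [Hpq [Hc [Hlen _]]]]].
  assert (HfarK : ~ near (E K) (eps n) p q).
  { intros [y [Hy Hyp]]. apply (HnE y); [lra|exact Hy]. }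
  destruct (Hg n p q Hc) as [Y [HY [Hosc _]]]. destruct (Hosc x Hpq) as [_ HYx].
  destruct HY as [[Hnear _]|[k [P' [Q' [z [_ [Hnear [_ [Hgd [HP [HQ [Hz [HzB ->]]]]]]]]]]]]].
  - exfalso. apply HfarK. destruct Hnear as [y [Hy Hyp]]. exists y.
    split; [|exact Hyp]. apply (exhaustion_mono f B E HE O); [lia|exact Hy].
  - assert (HKk : (K <= k)%nat).
    { apply Nat.nlt_ge. intros Hl. apply HfarK. destruct Hnear as [y [Hy Hyp]].
      exists y. split; [|exact Hyp]. now apply (exhaustion_mono f B E HE (S k)). }
    pose proof (eps_decr K k HKk).
    destruct Hgd as [_ [_ Hd]].
    assert (Hd' : Rabs (f x - f z) <= eps k) by (apply Hd; auto; lra).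
    apply Rabs_le_bounds in Hd'. apply Rabs_def2 in HYx.
    unfold Rdist. apply Rabs_def1; lra.
Qed.

Theorem mainTheorem5 (f : R -> R) :
  (exists g : nat -> R -> R,
      (forall n, swiatkowski (g n)) /\
      (forall x, Un_cv (fun n => g n x) (f x)))
  <-> classS f.
Proof.
  split.
  - intros [g [Hg Hlim]]. split.
    + apply limit_fun_Baire with g; [now apply swiatkowski_common_contpts|exact Hlim].
    + intros A HA e He. now apply limit_S_cond with g.
  - intros Hf. destruct (classS_exhaustion f Hf) as [B [E HE]].
    destruct (functional_choice _ (fun n => approximant_exists f B E n HE)) as [g Hg].
    exists g. split.
    + intros n. apply (approximant_swiatkowski f B E n (g n) HE); apply Hg.
    + apply (approximant_cv f B E g HE); apply Hg.
Qed.
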